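(* Let $A \in \mathcal{M}_n(\mathbb{H})$ be nilpotent. If $W(A)$ is a (closed) disk $\mathbb{D}_{\mathbb{H}}(c,r)=\{q\in\mathbb{H}: |q-c|\le r\}$ for some $c\in\mathbb{H}$, $r\ge 0$, then its center is the origin, i.e. $W(A)=\mathbb{D}_{\mathbb{H}}(0,r)$.
   Context: $\mathbb{H}$ denotes the real quaternions with basis $1,i,j,k$, $i^2=j^2=k^2=ijk=-1$; for $q\in\mathbb{H}$, $q^*$ is its conjugate and $|q|^2=qq^*$. For $\mathbf{x}\in\mathbb{H}^n$, $\mathbf{x}^*$ is the conjugate transpose, and $\mathbb{S}_{\mathbb{H}^n}=\{\mathbf{x}\in\mathbb{H}^n:\mathbf{x}^*\mathbf{x}=1\}$. The (quaternionic) numerical range of $A\in\mathcal{M}_n(\mathbb{H})$ is $W(A)=\{\mathbf{x}^*A\mathbf{x}:\mathbf{x}\in\mathbb{S}_{\mathbb{H}^n}\}\subseteq\mathbb{H}$. *)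

(* Defs.v *)
From Stdlib Require Import Reals.
From mathcomp Require Import all_boot.

Set Implicit Arguments.
Unset Strict Implicit.
Unset Printing Implicit Defensive.

Open Scope R_scope.

Record quat := Quat { qre : R; qim_i : R; qim_j : R; qim_k : R }.

Definition qzero : quat := Quat 0 0 0 0.
Definition qone  : quat := Quat 1 0 0 0.

Definition qadd (p q : quat) : quat :=
  Quat (qre p + qre q) (qim_i p + qim_i q) (qim_j p + qim_j q) (qim_k p + qim_k q).

Definition qopp (p : quat) : quat :=
  Quat (- qre p) (- qim_i p) (- qim_j p) (- qim_k p).

Definition qsub (p q : quat) : quat := qadd p (qopp q).

(* Hamilton product, i^2 = j^2 = k^2 = ijk = -1 *)
Definition qmul (p q : quat) : quat :=
  let a1 := qre p in let b1 := qim_i p in let c1 := qim_j p in let d1 := qim_k p in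
  let a2 := qre q in let b2 := qim_i q in let c2 := qim_j q in let d2 := qim_k q in
  Quat (a1*a2 - b1*b2 - c1*c2 - d1*d2)
       (a1*b2 + b1*a2 + c1*d2 - d1*c2)
       (a1*c2 - b1*d2 + c1*a2 + d1*b2)
       (a1*d2 + b1*c2 - c1*b2 + d1*a2).

Definition qconj (p : quat) : quat :=
  Quat (qre p) (- qim_i p) (- qim_j p) (- qim_k p).

Definition qnorm (p : quat) : R :=
  sqrt (qre p * qre p + qim_i p * qim_i p + qim_j p * qim_j p + qim_k p * qim_k p).

Definition qmat (n : nat) := 'I_n -> 'I_n -> quat.
Definition qvec (n : nat) := 'I_n -> quat.

Definition qsum (n : nat) (F : 'I_n -> quat) : quat :=
  \big[qadd/qzero]_(i < n) F i.

Definition qmxmul (n : nat) (A B : qmat n) : qmat n :=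
  fun i j => qsum (fun k => qmul (A i k) (B k j)).

Definition qmx1 (n : nat) : qmat n :=
  fun i j => if i == j then qone else qzero.

Definition qmxpow (n : nat) (A : qmat n) (k : nat) : qmat n :=
  ssrnat.iter k (qmxmul A) (@qmx1 n).

Definition qnilpotent (n : nat) (A : qmat n) : Prop :=
  exists k : nat, forall i j, qmxpow A k i j = qzero.

Definition qmxvec (n : nat) (A : qmat n) (x : qvec n) : qvec n :=
  fun i => qsum (fun j => qmul (A i j) (x j)).

Definition qdot (n : nat) (x y : qvec n) : quat :=
  qsum (fun i => qmul (qconj (x i)) (y i)).

Definition qsphere (n : nat) (x : qvec n) : Prop := qdot x x = qone.

Definition numrange (n : nat) (A : qmat n) (q : quat) : Prop :=
  exists x : qvec n, qsphere x /\ qdot x (qmxvec A x) = q.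

Definition qdisk (c : quat) (r : R) (q : quat) : Prop := qnorm (qsub q c) <= r.

(* Main.v *)
Require Import Defs.
From Stdlib Require Import Reals.
From HB Require Import structures.
From mathcomp Require Import all_boot all_order all_algebra.
From mathcomp Require Import separable cyclotomic ring complex Rstruct.

(** Writing [x = v + j w] with complex [v, w] identifies H^n with C^(2n), turns
    [A] into a nilpotent complex matrix [M], and turns the numerical range of
    [A] into its projection to C, so that W(M) is the complex disk of radius
    [r] whose centre [c'] is the complex part of [c].  Put [B = M - c'].  For
    every [|w| = 1] the Hermitian matrix [2 r - w^* B - w B^*] is positive
    semidefinite and its form vanishes at a unit vector realising the boundary
    point [c' + r w]; hence it is singular, and so is [B - 2 r w + w^2 B^*].
    The determinant of the latter is a polynomial in [w] vanishing on the unit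
    circle, so it vanishes at [w = 0]: [c'] is an eigenvalue of [M], whence
    [c' = 0].  As W(A) is invariant under [q |-> u^* q u] for unit [u], the same
    applies to [u^* c u], and these rotations bring every imaginary component
    of [c] into the complex part. *)

Set Implicit Arguments.
Unset Strict Implicit.
Unset Printing Implicit Defensive.

Import Order.TTheory GRing.Theory Num.Theory Num.Def.

Local Open Scope ring_scope.
Local Open Scope sesquilinear_scope.

Local Notation "''[' u , v ]" := (dotmx u v) : ring_scope.
Local Notation "''[' u ]" := '[u, u] : ring_scope.

Lemma nilpotent_eigenvalue_eq0 (F : fieldType) n (M : 'M[F]_n) (c : F) k :
  M ^+ k = 0 -> eigenvalue M c -> c = 0.
Proof.
move=> Mk0 /eigenvalueP[v vM v_neq0].
have : v *m M ^+ k = c ^+ k *: v.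
  elim: k {Mk0} => [|k IHk]; first by rewrite !expr0 scale1r mulmx1.
  by rewrite [M ^+ _]exprSr mulmxA IHk -scalemxAl vM scalerA -exprSr.
rewrite Mk0 mulmx0 => /esym/eqP; rewrite scaler_eq0 (negPf v_neq0) orbF.
by rewrite expf_eq0 => /andP[_ /eqP].
Qed.

Lemma norm_unity_root (K : numDomainType) n (z : K) :
  (0 < n)%N -> n.-unity_root z -> `|z| = 1.
Proof.
move=> n_gt0 /unity_rootP zn1; apply/eqP.
by rewrite -(pexpr_eq1 n_gt0) // -normrX zn1 normr1.
Qed.

Section ComplexNumericalRange.
Variable C : numClosedFieldType.

Lemma poly_unit_circle_eq0 (p : {poly C}) :
  (forall w, `|w| = 1 -> p.[w] = 0) -> p = 0.
Proof.
move=> p_circle0; pose n := (size p).+1; pose q : {poly C} := 'X^n - 1.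
have [rs q_rs] := closed_field_poly_normal q.
rewrite (monicP _) ?monicXnsubC // scale1r in q_rs.
apply: (@roots_geq_poly_eq0 _ p rs).
- apply/allP => z; rewrite -root_prod_XsubC -q_rs => z_root.
  exact/rootP/p_circle0/(@norm_unity_root _ n).
- by rewrite -separable_prod_XsubC -q_rs separable_Xn_sub_1 // pnatr_eq0.
- have := size_XnsubC (1 : C) (ltn0Sn (size p)).
  rewrite -/n -/q q_rs size_prod_XsubC => -[->]; exact: leqnSn.
Qed.

Lemma det_quadratic_pencil_eq0 n (B0 B1 B2 : 'M[C]_n) :
  (forall w, `|w| = 1 -> \det (B0 + w *: B1 + w ^+ 2 *: B2) = 0) ->
  \det B0 = 0.
Proof.
move=> det_circle0.
pose P : 'M[{poly C}]_n :=
  map_mx polyC B0 + 'X *: map_mx polyC B1 + 'X^2 *: map_mx polyC B2.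
have detP w : (\det P).[w] = \det (B0 + w *: B1 + w ^+ 2 *: B2).
  rewrite -horner_evalE -det_map_mx; congr (\det _).
  by apply/matrixP => i j; rewrite !mxE /= horner_evalE !hornerE.
have P0 : \det P = 0.
  by apply: poly_unit_circle_eq0 => w /det_circle0; rewrite detP.
by have := detP 0; rewrite P0 horner0 scale0r expr0n scale0r !addr0.
Qed.

(* As [v] is isotropic, [f (u - a v)] is affine in [a], hence takes negative
   values unless [f u v] vanishes. *)
Lemma psd_hermitian_isotropic (U : lmodType C)
    (f : {hermitian U for false & conjC}) (v : U) :
  (forall u, 0 <= f u u) -> f v v = 0 -> forall u, f u v = 0.
Proof.
move=> f_ge0 fvv0 u; apply/eqP/negPn/negP => fuv_neq0.
pose a := ((f u u + 1) / (f u v *+ 2))^*.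
have fuav : f u (a *: v) = (f u u + 1) / 2.
  by rewrite linearZr_LR /= conjCK -mulr_natl; field.
have fN1 : f (u - a *: v) (u - a *: v) = -1.
  rewrite hnormB fuav linearZl_LR linearZr_LR /= fvv0 !mulr0.
  by rewrite geC0_conj ?divr_ge0 ?addr_ge0 ?f_ge0 //; field.
by have := f_ge0 (u - a *: v); rewrite fN1 oppr_ge0 ler10.
Qed.

Lemma dotmx_eq0 n (u : 'rV[C]_n) : ('[u] == 0) = (u == 0).
Proof. exact: dnorm_eq0. Qed.

Lemma dotmx_trmxC n (M : 'M[C]_n) (u v : 'rV[C]_n) :
  '[u *m M^t*, v] = '[u, v *m M].
Proof. by rewrite !dotmxE trmx_mul map_mxM mulmxA. Qed.

Lemma dotmx_addtrmxC n (M : 'M[C]_n) (v : 'rV[C]_n) :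
  '[v *m (M + M^t*), v] = 'Re '[v *m M, v] *+ 2.
Proof.
rewrite mulmxDr linearDl /= dotmx_trmxC [X in _ + X]hermC expr0 mul1r ReE.
by field.
Qed.

Lemma psd_mulmx_eq0 n (H : 'M[C]_n) (v : 'rV[C]_n) :
  H^t* = H -> (forall u, 0 <= '[u *m H, u]) -> '[v *m H, v] = 0 -> v *m H = 0.
Proof.
move=> HtC H_ge0 vHv0.
have H_herm : H \is hermsymmx by rewrite is_hermitianmxE HtC expr0 scale1r.
pose f : {hermitian 'rV[C]_n for false & conjC} :=
  form_of_matrix conjC (HermitianMx H_herm).
have fE u w : f u w = '[u *m H, w].
  by rewrite /f /= /form_of_matrix trace_mx11 dotmxE.
apply/eqP; rewrite -dotmx_eq0 -fE hermC.
by rewrite psd_hermitian_isotropic ?rmorph0 ?mulr0 // => [u|]; rewrite fE.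
Qed.

Lemma Re_dotmx_max_eigenvector n (M : 'M[C]_n) (r : C) (v : 'rV[C]_n) :
    r \is Num.real -> (forall u, 'Re '[u *m M, u] <= r * '[u]) ->
    'Re '[v *m M, v] = r * '[v] ->
  v *m (M + M^t*) = (r *+ 2) *: v.
Proof.
move=> r_real Re_le Re_max; pose H := (r *+ 2)%:M - (M + M^t*).
have HE u : '[u *m H, u] = (r * '[u] - 'Re '[u *m M, u]) *+ 2.
  rewrite mulmxBr linearBl /= dotmx_addtrmxC mul_mx_scalar linearZl_LR /=.
  by rewrite mulrnAl mulrnBl.
apply/esym/eqP; rewrite -subr_eq0 -mul_mx_scalar -mulmxBr; apply/eqP.
apply: psd_mulmx_eq0 => [|u|]; last by rewrite HE Re_max subrr mul0rn.
- rewrite linearB linearD /= map_mxB map_mxD trmxCK tr_scalar_mx map_scalar_mx.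
  by rewrite rmorphMn /= (CrealP r_real) [_ + M]addrC.
- by rewrite HE pmulrn_lge0 // subr_ge0.
Qed.

(* The row [v] stands for the adjoint [x^*] of a column [x]. *)
Definition cnumrange n (M : 'M[C]_n) (z : C) : Prop :=
  exists2 v : 'rV[C]_n, '[v] = 1 & '[v *m M, v] = z.

Lemma cnumrange_subscalar n (M : 'M[C]_n) (c z : C) :
  cnumrange (M - c%:M) z <-> cnumrange M (z + c).
Proof.
split=> -[v v1 vMv]; exists v => //; move: vMv;
  rewrite mulmxBr linearBl /= mul_mx_scalar linearZl_LR /= v1 mulr1.
- by move<-; rewrite subrK.
- by move->; rewrite addrK.
Qed.

Lemma norm_dotmx_mulmx_le n (M : 'M[C]_n) (r : C) :
    (forall z, cnumrange M z -> `|z| <= r) ->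
  forall v, `|'[v *m M, v]| <= r * '[v].
Proof.
move=> W_le v; have [->|v_neq0] := eqVneq v 0.
  by rewrite mul0mx !linear0l normr0 mulr0.
have vv_gt0 : 0 < '[v] by rewrite dnorm_gt0.
pose a := (sqrtC '[v])^-1.
have aa : a * a^* = '[v]^-1.
  by rewrite -normCK ger0_norm ?invr_ge0 ?sqrtC_ge0 ?ltW // exprVn sqrtCK.
have /W_le : cnumrange M ('[v *m M, v] / '[v]).
  exists (a *: v); rewrite -?scalemxAl linearZl_LR linearZr_LR /= mulrA aa.
    by rewrite mulVf ?gt_eqF.
  by rewrite mulrC.
by rewrite normf_div [X in _ / X]gtr0_norm // ler_pdivrMr.
Qed.

(* At a unit vector realising the boundary point [r w], the real part of the
   form of [w^* B] attains its maximum [r]. *)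
Lemma cnumrange_disk0_pencil n (B : 'M[C]_n) (r w : C) : 0 <= r ->
    (forall z, cnumrange B z <-> `|z| <= r) -> `|w| = 1 ->
  \det (B + w *: (- (r *+ 2))%:M + w ^+ 2 *: B^t*) = 0.
Proof.
move=> r_ge0 WB w1.
have wcw : w^* * w = 1 by rewrite mulrC -normCK w1 expr1n.
have /WB[v v1 vBv] : `|r * w| <= r by rewrite normrM w1 mulr1 ger0_norm.
have : v *m (w^* *: B + (w^* *: B)^t*) = (r *+ 2) *: v.
  apply: Re_dotmx_max_eigenvector => [|u|]; first exact: ger0_real.
  - apply: le_trans (_ : `|'[u *m (w^* *: B), u]| <= _).
      by rewrite leif_Re_Creal.
    rewrite -scalemxAr linearZl_LR normrM norm_conjC w1 mul1r.
    by apply: norm_dotmx_mulmx_le => z /WB.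
  - rewrite -scalemxAr linearZl_LR /= vBv mulrCA wcw v1 !mulr1.
    exact/Creal_ReP/ger0_real.
rewrite linearZ map_mxZ /= conjCK mulmxDr -!scalemxAr => v_eigen.
apply/eqP/det0P; exists v; first by rewrite -dotmx_eq0 v1 oner_eq0.
rewrite !mulmxDr -!scalemxAr mul_mx_scalar scaleNr -v_eigen.
rewrite scalerN scalerDr !scalerA [w * _^*]mulrC wcw scale1r -expr2.
by rewrite addrAC subrr.
Qed.

Lemma cnumrange_disk0_singular n (B : 'M[C]_n) (r : C) : 0 <= r ->
  (forall z, cnumrange B z <-> `|z| <= r) -> \det B = 0.
Proof.
move=> r_ge0 WB; apply: det_quadratic_pencil_eq0 => w w1.
exact: cnumrange_disk0_pencil r_ge0 WB w1.
Qed.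

Lemma cnumrange_disk_center_eigenvalue n (M : 'M[C]_n) (c r : C) : 0 <= r ->
  (forall z, cnumrange M z <-> `|z - c| <= r) -> eigenvalue M c.
Proof.
move=> r_ge0 WM.
rewrite /eigenvalue /eigenspace kermx_eq0 row_free_unit unitmxE.
rewrite (cnumrange_disk0_singular r_ge0) ?unitr0 // => z.
by rewrite cnumrange_subscalar WM addrK.
Qed.

End ComplexNumericalRange.

Definition RringE := (RplusE, RminusE, RmultE, RoppE, R0E, R1E).

Lemma quat_eq (p q : quat) : qre p = qre q -> qim_i p = qim_i q ->
  qim_j p = qim_j q -> qim_k p = qim_k q -> p = q.
Proof. by case: p q => [? ? ? ?] [? ? ? ?] /= -> -> -> ->. Qed.

Local Ltac quat_ring :=
  by hnf; move=> *; apply: quat_eq; rewrite /= ?RringE; ring.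

Definition quat_coords (q : quat) : R * R * R * R :=
  (qre q, qim_i q, qim_j q, qim_k q).

Definition quat_of_coords (t : R * R * R * R) : quat :=
  let: (a, b, c, d) := t in Quat a b c d.

Lemma quat_coordsK : cancel quat_coords quat_of_coords.
Proof. by case. Qed.

HB.instance Definition _ := Choice.copy quat (can_type quat_coordsK).

Lemma qaddA : associative qadd. Proof. quat_ring. Qed.
Lemma qaddC : commutative qadd. Proof. quat_ring. Qed.
Lemma qadd0q : left_id qzero qadd. Proof. quat_ring. Qed.
Lemma qaddNq : left_inverse qzero qopp qadd. Proof. quat_ring. Qed.

HB.instance Definition _ :=
  GRing.isZmodule.Build quat qaddA qaddC qadd0q qaddNq.

Lemma qmulA : associative qmul. Proof. quat_ring. Qed.
Lemma qmul1q : left_id qone qmul. Proof. quat_ring. Qed.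
Lemma qmulq1 : right_id qone qmul. Proof. quat_ring. Qed.
Lemma qmulDl : left_distributive qmul qadd. Proof. quat_ring. Qed.
Lemma qmulDr : right_distributive qmul qadd. Proof. quat_ring. Qed.

HB.instance Definition _ :=
  GRing.Zmodule_isPzRing.Build quat qmulA qmul1q qmulq1 qmulDl qmulDr.

Lemma qconj1 : qconj 1 = 1. Proof. quat_ring. Qed.
Lemma qconjK : involutive qconj. Proof. quat_ring. Qed.

Lemma qconjM (p q : quat) : qconj (p * q) = qconj q * qconj p.
Proof. quat_ring. Qed.

Lemma qmul_conjC (q : quat) : q * qconj q = qconj q * q.
Proof. quat_ring. Qed.

Lemma qnormE (q : quat) : qnorm q =
  Num.sqrt (qre q ^+ 2 + qim_i q ^+ 2 + qim_j q ^+ 2 + qim_k q ^+ 2).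
Proof. by rewrite /qnorm RsqrtE !RringE. Qed.

Lemma qnorm_ge0 (q : quat) : 0 <= qnorm q.
Proof. by rewrite qnormE sqrtr_ge0. Qed.

Lemma qnorm1 : qnorm 1 = 1.
Proof. by rewrite qnormE /= !RringE expr1n expr0n !addr0 sqrtr1. Qed.

Lemma qnormM (p q : quat) : qnorm (p * q) = qnorm p * qnorm q.
Proof.
rewrite !qnormE -sqrtrM; last by rewrite !addr_ge0 ?sqr_ge0.
by congr Num.sqrt; rewrite /= !RringE; ring.
Qed.

Definition qunit (u : quat) : Prop := qconj u * u = 1.

Lemma qunit1 : qunit 1.
Proof. by rewrite /qunit qconj1 mulr1. Qed.

Lemma qunitM (u v : quat) : qunit u -> qunit v -> qunit (u * v).
Proof.
by move=> u1 v1; rewrite /qunit qconjM mulrA -(mulrA (qconj v)) u1 mulr1.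
Qed.

Lemma qunit_conj (u : quat) : qunit u -> qunit (qconj u).
Proof. by rewrite /qunit qconjK qmul_conjC. Qed.

Definition qrot (u q : quat) : quat := qconj u * q * u.

Lemma qrot1 (q : quat) : qrot 1 q = q.
Proof. by rewrite /qrot qconj1 mul1r mulr1. Qed.

Lemma qrotM (u v q : quat) : qrot (u * v) q = qrot v (qrot u q).
Proof. by rewrite /qrot qconjM !mulrA. Qed.

Lemma qrotB (u p q : quat) : qrot u (p - q) = qrot u p - qrot u q.
Proof. by rewrite /qrot mulrBr mulrBl. Qed.

Lemma qrotK (u : quat) : qunit u -> cancel (qrot u) (qrot (qconj u)).
Proof. by move=> u1 q; rewrite -qrotM qmul_conjC u1 qrot1. Qed.

Lemma qrotVK (u : quat) : qunit u -> cancel (qrot (qconj u)) (qrot u).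
Proof. by move=> /qunit_conj/qrotK; rewrite qconjK. Qed.

Lemma qnorm_rot (u q : quat) : qunit u -> qnorm (qrot u q) = qnorm q.
Proof. by move=> u1; rewrite !qnormM mulrAC -qnormM u1 qnorm1 mul1r. Qed.

Lemma qdisk_rot (c u q : quat) r :
  qunit u -> qdisk (qrot u c) r (qrot u q) <-> qdisk c r q.
Proof.
move=> u1; rewrite /qdisk -(qnorm_rot (qsub q c) u1).
by rewrite -[qsub q c]/(q - c) qrotB.
Qed.

Lemma qdotE n (x y : qvec n) : qdot x y = \sum_i qconj (x i) * y i.
Proof. by []. Qed.

Lemma qmxvecE n (A : qmat n) (x : qvec n) i : qmxvec A x i = \sum_j A i j * x j.
Proof. by []. Qed.

Lemma qdot_mulr n (x y : qvec n) u :
  qdot (fun i => x i * u) (fun i => y i * u) = qrot u (qdot x y).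
Proof.
rewrite /qrot !qdotE mulr_sumr mulr_suml.
by apply: eq_bigr => i _; rewrite qconjM !mulrA.
Qed.

Lemma numrange_rot n (A : qmat n) u q :
  qunit u -> numrange A q -> numrange A (qrot u q).
Proof.
move=> u1 [x [x1 <-]]; exists (fun i => x i * u); split.
  by rewrite /qsphere qdot_mulr x1 /qrot mulr1.
rewrite -qdot_mulr; apply: eq_bigr => i _; congr (_ * _).
by rewrite !qmxvecE mulr_suml; apply: eq_bigr => j _; apply: mulrA.
Qed.

Lemma numrange_disk_rot n (A : qmat n) c r u : qunit u ->
    (forall q, numrange A q <-> qdisk c r q) ->
  forall q, numrange A q <-> qdisk (qrot u c) r q.
Proof.
move=> u1 WA q; rewrite -(qrotVK u1 q) qdisk_rot // -WA.
split=> [/(numrange_rot (qunit_conj u1))|/(numrange_rot u1)] //.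
by rewrite qrotK.
Qed.

(* Conjugation by the Hurwitz unit [(1 + i + j + k) / 2] permutes [i], [j] and
   [k] cyclically. *)
Definition qhurwitz : quat := let h : R := 2^-1 in Quat h h h h.

Lemma qunit_hurwitz : qunit qhurwitz.
Proof. by apply: quat_eq; rewrite /= !RringE; field. Qed.

Lemma qrot_hurwitz q :
  qrot qhurwitz q = Quat (qre q) (qim_j q) (qim_k q) (qim_i q).
Proof. by apply: quat_eq; rewrite /= !RringE; field. Qed.

Local Notation C := (complex R).

(* [q = cpart q + j * jpart q], so that right multiplication by a complex scalar
   is componentwise and left multiplication by a quaternion is C-linear. *)
Definition cpart (q : quat) : C := Complex (qre q) (qim_i q).
Definition jpart (q : quat) : C := Complex (qim_j q) (- qim_k q).

Definition quat_of_parts (a b : C) : quat :=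
  Quat (complex.Re a) (complex.Im a) (complex.Re b) (- complex.Im b).

Lemma quat_of_partsK q : quat_of_parts (cpart q) (jpart q) = q.
Proof. by apply: quat_eq => //=; apply: opprK. Qed.

Lemma cpart_of_parts a b : cpart (quat_of_parts a b) = a.
Proof. by case: a. Qed.

Lemma jpart_of_parts a b : jpart (quat_of_parts a b) = b.
Proof. by case: b => x y; rewrite /jpart /= opprK. Qed.

Lemma cpart_is_zmod_morphism : zmod_morphism cpart.
Proof. by []. Qed.

Lemma jpart_is_zmod_morphism : zmod_morphism jpart.
Proof. by move=> p q; congr Complex; rewrite /= !RringE opprD. Qed.

HB.instance Definition _ :=
  GRing.isZmodMorphism.Build quat C cpart cpart_is_zmod_morphism.
HB.instance Definition _ :=
  GRing.isZmodMorphism.Build quat C jpart jpart_is_zmod_morphism.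

Lemma jpart1 : jpart 1 = 0.
Proof. by congr Complex; rewrite oppr0. Qed.

Lemma cpartM p q : cpart (p * q) = cpart p * cpart q - (jpart p)^* * jpart q.
Proof. by congr Complex; rewrite /= !RringE; ring. Qed.

Lemma jpartM p q : jpart (p * q) = jpart p * cpart q + (cpart p)^* * jpart q.
Proof. by congr Complex; rewrite /= !RringE; ring. Qed.

Lemma cpart_conj q : cpart (qconj q) = (cpart q)^*.
Proof. by []. Qed.

Lemma jpart_conj q : jpart (qconj q) = - jpart q.
Proof. by []. Qed.

Lemma cpart_rot_eq0 (q : quat) :
  (forall u, qunit u -> cpart (qrot u q) = 0) -> q = 0.
Proof.
pose w := qhurwitz; have w1 : qunit w := qunit_hurwitz => q_rot.
have [re0 i0] : cpart q = 0 by rewrite -(q_rot 1 qunit1) qrot1.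
have := q_rot w w1; rewrite qrot_hurwitz => -[_ j0].
have := q_rot (w * w) (qunitM w1 w1); rewrite qrotM !qrot_hurwitz => -[_ k0].
exact: quat_eq.
Qed.

Lemma sqr_qnorm q : (qnorm q)%:C%C ^+ 2 = `|cpart q| ^+ 2 + `|jpart q| ^+ 2.
Proof.
rewrite -!add_Re2_Im2 -rmorphXn -rmorphD qnormE sqr_sqrtr ?addr_ge0 ?sqr_ge0 //.
by rewrite /= sqrrN !addrA.
Qed.

Lemma norm_cpart_le q : `|cpart q| <= (qnorm q)%:C%C.
Proof.
rewrite -ler_sqr ?nnegrE ?normr_ge0 ?ler0c ?qnorm_ge0 // sqr_qnorm.
by rewrite lerDl exprn_ge0.
Qed.

Lemma norm_cpart q : jpart q = 0 -> `|cpart q| = (qnorm q)%:C%C.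
Proof.
move=> jq0; apply/eqP.
rewrite -(@eqrXn2 _ 2) ?normr_ge0 ?ler0c ?qnorm_ge0 //.
by rewrite sqr_qnorm jq0 normr0 expr0n addr0.
Qed.

Lemma cpart_qdisk c r z :
  (exists2 q, qdisk c r q & cpart q = z) <-> `|z - cpart c| <= r%:C%C.
Proof.
split=> [[q /RleP q_in <-]|z_in].
  by rewrite -raddfB (le_trans (norm_cpart_le _)) // lecR; apply: q_in.
exists (quat_of_parts z (jpart c)); last exact: cpart_of_parts.
apply/RleP; rewrite -[qsub _ c]/(_ - c) -lecR -norm_cpart raddfB /=.
  by rewrite cpart_of_parts.
by rewrite jpart_of_parts subrr.
Qed.

Definition qj : quat := Quat 0 0 1 0.

Lemma cpart_mulqj q : cpart (q * qj) = - (jpart q)^*.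
Proof. by congr Complex; rewrite /= !RringE; ring. Qed.

Lemma jpart_mulqj q : jpart (q * qj) = (cpart q)^*.
Proof. by congr Complex; rewrite /= !RringE; ring. Qed.

Definition rscalemx m n (A : 'M[quat]_(m, n)) (q : quat) : 'M[quat]_(m, n) :=
  map_mx ( *%R^~ q) A.

Lemma rscale0mx m n q : rscalemx (0 : 'M_(m, n)) q = 0.
Proof. by apply/matrixP => i j; rewrite !mxE mul0r. Qed.

Lemma rscalemxAr m n p (A : 'M[quat]_(m, n)) (B : 'M[quat]_(n, p)) q :
  rscalemx (A *m B) q = A *m rscalemx B q.
Proof.
apply/matrixP => i k; rewrite !mxE mulr_suml.
by apply: eq_bigr => j _; rewrite !mxE mulrA.
Qed.

Definition ccol m n (X : 'M[quat]_(m, n)) : 'M[C]_(m + m, n) :=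
  col_mx (map_mx cpart X) (map_mx jpart X).

Lemma ccol0 m n : ccol (0 : 'M_(m, n)) = 0.
Proof. by rewrite /ccol !map_mx0 col_mx0. Qed.

(* The matrix of [x |-> A x] in the basis [e_i], [e_i j] of H^n as a right
   vector space over C. *)
Definition cmx m n (A : 'M[quat]_(m, n)) : 'M[C]_(m + m, n + n) :=
  row_mx (ccol A) (ccol (rscalemx A qj)).

Lemma cmx_ccol m n p (A : 'M[quat]_(m, n)) (X : 'M[quat]_(n, p)) :
  cmx A *m ccol X = ccol (A *m X).
Proof.
rewrite mul_row_col !mul_col_mx add_col_mx; congr col_mx; apply/matrixP => i k;
  rewrite !mxE raddf_sum -big_split; apply: eq_bigr => j _; rewrite !mxE.
- by rewrite cpart_mulqj /= cpartM mulNr.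
- by rewrite jpart_mulqj /= jpartM.
Qed.

Lemma cmxM m n p (A : 'M[quat]_(m, n)) (B : 'M[quat]_(n, p)) :
  cmx (A *m B) = cmx A *m cmx B.
Proof. by rewrite mul_mx_row !cmx_ccol -rscalemxAr. Qed.

Lemma cmx0 m n : cmx (0 : 'M_(m, n)) = 0.
Proof. by rewrite /cmx rscale0mx !ccol0 row_mx0. Qed.

Lemma cmx1 n : cmx (1%:M : 'M_n) = 1%:M.
Proof.
rewrite (scalar_mx_block n n 1) block_mxEh; congr row_mx; congr col_mx;
  apply/matrixP => i j; rewrite !mxE ?cpart_mulqj ?jpart_mulqj; case: (i == j);
  by rewrite ?rmorph1 ?jpart1 ?raddf0 ?oppr0.
Qed.

Lemma cmxX n (A : 'M[quat]_n) k : cmx (A ^+ k) = cmx A ^+ k.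
Proof.
elim: k => [|k IHk]; first by rewrite !expr0 cmx1.
by rewrite !exprS -IHk cmxM.
Qed.

Definition mx_of_qmat n (A : qmat n) : 'M[quat]_n := \matrix_(i, j) A i j.

Lemma mx_of_qmatX n (A : qmat n) k :
  mx_of_qmat (qmxpow A k) = mx_of_qmat A ^+ k.
Proof.
elim: k => [|k IHk].
  by apply/matrixP => i j; rewrite !mxE /= /qmx1; case: eqP.
rewrite exprS -IHk; apply/matrixP => i j; rewrite !mxE.
by apply: eq_bigr => l _; rewrite !mxE.
Qed.

Lemma qnilpotent_cmx n (A : qmat n) :
  qnilpotent A -> exists k, cmx (mx_of_qmat A) ^+ k = 0.
Proof.
move=> [k Ak0]; exists k; rewrite -cmxX -mx_of_qmatX -[RHS]cmx0; congr cmx.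
by apply/matrixP => i j; rewrite !mxE.
Qed.

Definition cvec n (x : qvec n) : 'cV[C]_(n + n) := ccol (\col_i x i).

Lemma cvec_surj n (v : 'cV[C]_(n + n)) : exists x : qvec n, cvec x = v.
Proof.
exists (fun i => quat_of_parts (v (lshift n i) 0) (v (rshift n i) 0)).
rewrite -[RHS]vsubmxK; congr col_mx; apply/colP => i; rewrite !mxE.
- exact: cpart_of_parts.
- exact: jpart_of_parts.
Qed.

Lemma cvec_qmxvec n (A : qmat n) x :
  cvec (qmxvec A x) = cmx (mx_of_qmat A) *m cvec x.
Proof.
rewrite cmx_ccol; congr ccol; apply/colP => i; rewrite !mxE.
by apply: eq_bigr => j _; rewrite !mxE.
Qed.

Lemma cpart_qdot n (x y : qvec n) :
  cpart (qdot x y) = '[(cvec x)^t*, (cvec y)^t*].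
Proof.
rewrite dotmxE trmxCK tr_col_mx map_row_mx mul_row_col !mxE.
rewrite qdotE raddf_sum -big_split; apply: eq_bigr => i _; rewrite !mxE /=.
by rewrite cpartM cpart_conj jpart_conj rmorphN mulNr opprK.
Qed.

Lemma jpart_qdot n (x : qvec n) : jpart (qdot x x) = 0.
Proof.
rewrite qdotE raddf_sum big1 //= => i _.
by rewrite jpartM cpart_conj jpart_conj conjCK mulNr mulrC addNr.
Qed.

Lemma qsphereE n (x : qvec n) : qsphere x <-> '[(cvec x)^t*] = 1.
Proof.
rewrite -cpart_qdot /qsphere; split=> [->//|x1].
rewrite -[LHS]quat_of_partsK x1 jpart_qdot -jpart1.
exact: (quat_of_partsK 1).
Qed.

Lemma cnumrange_cmx n (A : qmat n) z :
  cnumrange (cmx (mx_of_qmat A)) z <-> exists2 q, numrange A q & cpart q = z.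
Proof.
have dotE x : '[(cvec x)^t* *m cmx (mx_of_qmat A), (cvec x)^t*] =
    cpart (qdot x (qmxvec A x)).
  by rewrite cpart_qdot !dotmxE !trmxCK -mulmxA cvec_qmxvec.
split=> [[v v1 <-]|[_ [x [/qsphereE x1 <-]] <-]]; last by exists ((cvec x)^t*).
have [x xv] := cvec_surj (v^t*); exists (qdot x (qmxvec A x)).
  by exists x; split=> //; apply/qsphereE; rewrite xv trmxCK.
by rewrite -dotE xv trmxCK.
Qed.

Lemma nilpotent_disk_cpart_center n (A : qmat n) c r : Rle 0 r ->
  qnilpotent A -> (forall q, numrange A q <-> qdisk c r q) -> cpart c = 0.
Proof.
move=> /RleP r_ge0 /qnilpotent_cmx[k Ak0] WA.
apply: (nilpotent_eigenvalue_eq0 Ak0).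
apply: (@cnumrange_disk_center_eigenvalue _ _ _ _ r%:C%C).
  by rewrite ler0c.
move=> z; rewrite cnumrange_cmx -cpart_qdisk.
by split=> -[q /WA q_in <-]; exists q.
Qed.

Local Open Scope R_scope.

Theorem theorem3p1 (n : nat) (A : qmat n) (c : quat) (r : R) :
  qnilpotent A -> 0 <= r ->
  (forall q, numrange A q <-> qdisk c r q) ->
  c = qzero /\ (forall q, numrange A q <-> qdisk qzero r q).
Proof.
move=> nilA r_ge0 WA; suff c0 : c = qzero by split=> // q; rewrite -c0.
apply: cpart_rot_eq0 => u u1.
exact: nilpotent_disk_cpart_center r_ge0 nilA (numrange_disk_rot u1 WA).
Qed.
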